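(* Let $\Omega\subset\mathbb{R}^d$ be a bounded domain and let $V\in L^\infty(\Omega)$ be real-valued. Let $(\lambda_j)_{j\ge1}$ be the eigenvalues (repeated with multiplicity) and $(\phi_j)_{j\ge1}$ a corresponding orthonormal basis of $L^2(\Omega)$ of real-valued eigenfunctions of $-\Delta+V$ on $\Omega$ with Dirichlet boundary conditions, and put $J^V(\chi_\omega)=\inf_{j\ge1}\int_\omega\phi_j^2(x)\,dx$. Then $C_\infty^V(\chi_\omega)\le J^V(\chi_\omega)$ for every measurable subset $\omega$ of $\Omega$. If moreover every eigenvalue of $-\Delta+V$ is simple, then $$C_\infty^V(\chi_\omega)=\inf_{j\ge1}\int_\omega\phi_j^2(x)\,dx=J^V(\chi_\omega)$$ for every measurable subset $\omega$ of $\Omega$.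
   Context: Consider the Schrödinger equation $i\partial_t u=\Delta u-V(x)u$ on $\mathbb{R}\times\Omega$, with $u(0,x)=u_0(x)$ and $u(t,x)=0$ for $x\in\partial\Omega$, where $u_0\in H_0^1(\Omega)\cap H^2(\Omega)$. Its solution is $u(t,x)=\sum_{j\ge1}c_je^{i\lambda_jt}\phi_j(x)$ with $c_j=\int_\Omega u_0\overline{\phi_j}\,dx$, and $\|\partial_tu(0,\cdot)\|_{L^2(\Omega)}^2=\sum_j\lambda_j^2|c_j|^2$. The time asymptotic observability constant is $$C_\infty^V(\chi_\omega)=\inf\left\{\lim_{T\to\infty}\frac1T\,\frac{\int_0^T\int_\omega|\partial_tu(t,x)|^2\,dx\,dt}{\|\partial_tu(0,\cdot)\|_{L^2(\Omega)}^2}\ :\ u(0,\cdot)\in H_0^1(\Omega)\cap H^2(\Omega)\right\},$$ where the infimum is over initial data for which the quotient is defined (i.e. $\partial_tu(0,\cdot)\neq0$).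
   Formalization: Added: no eigenvalue of −Δ+V is 0; without it the claim fails (Ω=(0,π), V=−1, ω=(0,a)∪(π−a,π), a<π/2). Eigenfunctions are taken in H¹₀∩H², the space of admissible data, and measurable sets are Borel. *)

(* Defs.v *)
From HB Require Import structures.
From mathcomp Require Import all_boot all_order all_algebra complex.
From mathcomp Require Import all_classical all_reals all_analysis measurable_realfun.
Set Implicit Arguments.
Unset Strict Implicit.
Unset Printing Implicit Defensive.
Import Order.TTheory GRing.Theory Num.Theory.
Import numFieldNormedType.Exports.
Local Open Scope classical_set_scope.
Local Open Scope ring_scope.

Section borel_rV.
Context {R : realType} {n : nat}.

Definition borel_rV : set_system 'rV[R]_n := <<s (@open 'rV[R]_n) >>.

Let borel_rV0 : borel_rV set0.
Proof. exact: sigma_algebra0. Qed.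

Let borel_rVC A : borel_rV A -> borel_rV (~` A).
Proof. exact: sigma_algebraC. Qed.

Let borel_rV_bigcup (F : (set 'rV[R]_n)^nat) :
  (forall i, borel_rV (F i)) -> borel_rV (\bigcup_i F i).
Proof. exact: sigma_algebra_bigcup. Qed.

HB.instance Definition _ := @isMeasurable.Build default_measure_display
  'rV[R]_n borel_rV borel_rV0 borel_rVC borel_rV_bigcup.

Lemma open_measurable_rV (A : set 'rV[R]_n) : open A -> measurable A.
Proof. by move=> oA; apply: sub_sigma_algebra. Qed.

End borel_rV.

Section consrV.
Context {R : realType} {n : nat}.

Definition consrV (p : R * 'rV[R]_n) : 'rV[R]_n.+1 :=
  \row_i if unlift ord0 i is Some j then p.2 ord0 j else p.1.

Definition unconsrV (x : 'rV[R]_n.+1) : R * 'rV[R]_n :=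
  (x ord0 ord0, \row_i x ord0 (lift ord0 i)).

Lemma consrVK : cancel consrV unconsrV.
Proof.
move=> [a x]; rewrite /unconsrV mxE unlift_none; congr pair.
by apply/rowP => i; rewrite !mxE liftK.
Qed.

Lemma open_rV_cover (O : set 'rV[R]_n.+1) : open O ->
  O = \bigcup_(q : 'rV[rat]_n.+1 * nat)
    [set x | ball (map_mx ratr q.1 : 'rV[R]_n.+1) q.2.+1%:R^-1 `<=` O /\
       ball (map_mx ratr q.1 : 'rV[R]_n.+1) q.2.+1%:R^-1 x].
Proof.
move=> oO; rewrite eqEsubset; split=> [x Ox|x [q _ [+ +]]]; last exact.
have /nbhs_ballP[e /= e0 xeO] : nbhs x O by exact: open_nbhs_nbhs.
have [m mlt] : exists m : nat, m.+1%:R^-1 < e / 2.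
  have e20 : 0 < e / 2 by rewrite divr_gt0.
  have [N _ /(_ N (leqnn N))/= NP] := near_infty_natSinv_lt (PosNum e20).
  by exists N.
have m0 : 0 < (m.+1%:R^-1 : R) by rewrite invr_gt0.
have qP i : exists q : rat, `|x ord0 i - ratr q| < m.+1%:R^-1.
  have : x ord0 i < x ord0 i + m.+1%:R^-1 by rewrite ltrDl.
  move=> /rat_in_itvoo[q]; rewrite in_itv/= => /andP[q1 q2].
  by exists q; rewrite distrC gtr0_norm ?subr_gt0 // ltrBlDl.
pose q := \row_i projT1 (cid (qP i)).
exists (q, m) => //=.
have xq : ball (map_mx ratr q : 'rV[R]_n.+1) m.+1%:R^-1 x.
  apply: (conj m0) => i j.
  by rewrite /ball/= (ord1 i) !mxE distrC; case: cid.
split=> // y qy; apply: xeO.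
apply: (@le_ball _ _ _ (m.+1%:R^-1 + m.+1%:R^-1)).
  by rewrite (splitr e) lerD// ltW.
by apply: ball_triangle qy; exact: ball_sym.
Qed.

Lemma measurable_consrV : measurable_fun setT consrV.
Proof.
apply: (measurability (@open 'rV[R]_n.+1)) => // _ [U oU <-].
rewrite setTI (open_rV_cover oU) preimage_bigcup.
apply: countable_bigcupT_measurable; first exact: countableP.
move=> -[q m]/=; set B := ball _ _.
have [BO|BO] := pselect (B `<=` U); last first.
  by rewrite (_ : _ @^-1` _ = set0)// -subset0 => p [].
rewrite (_ : _ @^-1` _ = ball (ratr (q ord0 ord0) : R) m.+1%:R^-1 `*`
    ball (map_mx ratr (\row_i q ord0 (lift ord0 i)) : 'rV[R]_n) m.+1%:R^-1).
  apply: measurableX.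
    by apply: open_measurable; exact: ball_open.
  by apply: open_measurable_rV; exact: ball_open.
rewrite eqEsubset; split=> [p [_ [m0 Bp]]|p [p1 [m0 p2]]].
  split; first by have := Bp ord0 ord0; rewrite !mxE unlift_none.
  apply: (conj m0) => i j; have := Bp ord0 (lift ord0 j).
  by rewrite (ord1 i) !mxE liftK.
split=> //; apply: (conj m0) => i j; rewrite (ord1 i) !mxE.
by case: unliftP => [k ->|->//]; have := p2 ord0 k; rewrite !mxE.
Qed.

Lemma measurable_unconsrV : measurable_fun setT unconsrV.
Proof.
apply: measurable_fun_pair.
  apply: (measurability _ (RGenOpens.measurableE R)) => _ [_ [a [b ->] <-]].
  rewrite setTI; apply: open_measurable_rV.
  by apply: open_comp => // x _; exact: coord_continuous.
apply: (measurability (@open 'rV[R]_n)) => // _ [A oA <-].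
rewrite setTI; apply: open_measurable_rV.
apply: open_comp => // x _ B /nbhs_ballP[e e0 eB]; apply/nbhs_ballP.
exists e => // y [_ xy]; apply: eB; apply: (conj e0) => i j.
by rewrite (ord1 i) !mxE; exact: xy.
Qed.

Variable m : {sigma_finite_measure set 'rV[R]_n -> \bar R}.

Definition measure_consrV : set 'rV[R]_n.+1 -> \bar R :=
  pushforward (lebesgue_measure \x m)%E consrV.

Let measure_consrV0 : measure_consrV set0 = 0%E.
Proof. by rewrite /measure_consrV /pushforward preimage_set0 measure0. Qed.

Let measure_consrV_ge0 A : (0 <= measure_consrV A)%E.
Proof. by rewrite /measure_consrV /pushforward measure_ge0. Qed.

Let measurable_preimage_consrV A : measurable A -> measurable (consrV @^-1` A).
Proof. by move=> mA; rewrite -[X in measurable X]setTI; exact: measurable_consrV. Qed.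

Let measure_consrV_sigma_additive : semi_sigma_additive measure_consrV.
Proof.
move=> F mF tF mUF; rewrite /measure_consrV /pushforward preimage_bigcup.
apply: measure_semi_sigma_additive.
- by move=> k; exact: measurable_preimage_consrV.
- apply/trivIsetP => /= i j _ _ ij; rewrite -preimage_setI.
  by move/trivIsetP : tF => /(_ _ _ _ _ ij) ->//; rewrite preimage_set0.
- by rewrite -preimage_bigcup; exact: measurable_preimage_consrV.
Qed.

HB.instance Definition _ := isMeasure.Build _ _ _ measure_consrV
  measure_consrV0 measure_consrV_ge0 measure_consrV_sigma_additive.

Let measure_consrV_sigma_finite : sigma_finite setT measure_consrV.
Proof.
have /sigma_finiteP[F [TF ndF Foo]] : sigma_finite setT (@lebesgue_measure R).
  exact: sigma_finiteT.
have /sigma_finiteP[G [TG ndG Goo]] := sigma_finiteT m.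
exists (fun k => unconsrV @^-1` (F k `*` G k)).
  rewrite -preimage_bigcup -(preimage_setT unconsrV); congr (_ @^-1` _).
  rewrite -setXTT TF TG predeqE => -[x y]; split.
    move=> [/= [i _ Fx] [j _ Gy]]; exists (maxn i j) => //; split.
    - by move: x Fx; exact/subsetPset/ndF/leq_maxl.
    - by move: y Gy; exact/subsetPset/ndG/leq_maxr.
  by move=> [i _ []/= ? ?]; split; exists i.
move=> k; have [mF Fk] := Foo k; have [mG Gk] := Goo k; split.
  rewrite -[X in measurable X]setTI; apply: measurable_unconsrV => //.
  exact: measurableX.
rewrite /measure_consrV /pushforward -comp_preimage.
rewrite (_ : unconsrV \o consrV = id); last by apply/funext => p; exact: consrVK.
by rewrite preimage_id product_measure1E// lte_mul_pinfty// ge0_fin_numE.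
Qed.

HB.instance Definition _ := @Measure_isSigmaFinite.Build _ _ _ measure_consrV
  measure_consrV_sigma_finite.

End consrV.

(* Lebesgue measure on R^n, as an iterated product; the row vector x of R^n.+1 is
   identified with the pair of its first entry and of the remaining ones. *)
Fixpoint lebesgue_rV {R : realType} (n : nat) :
    {sigma_finite_measure set 'rV[R]_n -> \bar R} :=
  match n with
  | 0%N => \d_(0 : 'rV[R]_0)
  | n'.+1 => measure_consrV (lebesgue_rV n')
  end.

Lemma lebesgue_rV_box {R : realType} (n : nat) (A : 'I_n -> set R) :
  (forall i, measurable (A i)) ->
  lebesgue_rV n [set x : 'rV[R]_n | forall i, A i (x ord0 i)] =
  (\prod_(i < n) lebesgue_measure (A i))%E.
Proof.
elim: n A => [|n ih] A mA.
  rewrite big_ord0 /= (_ : [set _ | _] = setT) ?diracT//.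
  by rewrite -subTset => x _ [].
rewrite big_ord_recl /= -ih// /measure_consrV /pushforward.
rewrite -product_measure1E//; last 2 first.
  exact: mA.
  rewrite (_ : [set x | _] =
      \bigcap_(i in [set: 'I_n]) ((fun x : 'rV[R]_n => x ord0 i) @^-1` A (lift ord0 i))).
    apply: fin_bigcap_measurable => // i _.
    rewrite -[X in measurable X]setTI.
    suff : measurable_fun setT (fun x : 'rV[R]_n => x ord0 i) by exact.
    apply: (measurability _ (RGenOpens.measurableE R)) => _ [_ [a [b ->] <-]].
    rewrite setTI; apply: open_measurable_rV.
    by apply: open_comp => // x _; exact: coord_continuous.
  by rewrite eqEsubset; split=> x /= Ax i; [move=> _|]; exact: Ax.
apply: (congr1 (lebesgue_measure \x lebesgue_rV n)%E).
rewrite eqEsubset; split=> [[a x] /= H|[a x] /= [Aa Ax] i].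
  split=> /= [|i]; first by have := H ord0; rewrite mxE unlift_none.
  by have := H (lift ord0 i); rewrite mxE liftK.
by rewrite mxE; case: unliftP => [j ->|->].
Qed.

(* Functions on Omega are represented by total functions on R^d of which only
   the values on Omega matter, and elements of L^2(Omega) by representatives;
   equality in L^2(Omega) is equality almost everywhere in Omega. *)
Section sobolev.
Context {R : realType} {d : nat}.
Local Notation E := 'rV[R]_d.
Local Notation mu := (@lebesgue_rV R d).
Implicit Types (Omega omega : set E) (f g psi V : E -> R).

Definition bounded_domain Omega : Prop :=
  [/\ open Omega, connected Omega, Omega !=set0 & bounded_set Omega].

Definition ae_eq_in (T : Type) Omega (f g : E -> T) : Prop :=
  {ae mu, forall x, Omega x -> f x = g x}.

Definition L2 Omega f : Prop :=
  measurable_fun Omega f /\ mu.-integrable Omega (fun x => (f x ^+ 2)%:E).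

Definition Linfty Omega f : Prop :=
  measurable_fun Omega f /\
  exists M, {ae mu, forall x, Omega x -> `|f x| <= M}.

Definition cvg_L2 (I : Type) (F : set_system I) Omega (f_ : I -> E -> R) f : Prop :=
  (\int[mu]_(x in Omega) ((f_ i x - f x) ^+ 2)%:E)%E @[i --> F] --> 0%E.

Definition partial (i : 'I_d) f : E -> R := fun x => 'D_(delta_mx ord0 i) f x.

(* If all iterated partial derivatives are differentiable, they are all
   continuous; hence this is C^oo(R^d). *)
Definition smooth f : Prop :=
  forall (s : seq 'I_d) (x : E), differentiable (foldr partial f s) x.

Definition test_function Omega psi : Prop :=
  smooth psi /\
  exists K, [/\ compact K, K `<=` Omega & forall x, ~ K x -> psi x = 0].

Definition weak_partial Omega (i : 'I_d) f g : Prop :=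
  [/\ L2 Omega f, L2 Omega g & forall psi, test_function Omega psi ->
    \int[mu]_(x in Omega) (f x * partial i psi x) =
    - \int[mu]_(x in Omega) (g x * psi x)].

Definition H1 Omega f : Prop :=
  L2 Omega f /\ forall i, exists g, weak_partial Omega i f g.

Definition H2 Omega f : Prop :=
  L2 Omega f /\ forall i, exists2 g, weak_partial Omega i f g & H1 Omega g.

(* The closure of the test functions in H^1(Omega). *)
Definition H10 Omega f : Prop :=
  L2 Omega f /\
  exists (grad : 'I_d -> E -> R) (psi : nat -> E -> R),
    [/\ forall i, weak_partial Omega i f (grad i),
        forall n, test_function Omega (psi n),
        cvg_L2 \oo Omega psi f &
        forall i, cvg_L2 \oo Omega (fun n => partial i (psi n)) (grad i)].

(* g is the distributional Laplacian of f on Omega, with f and g in L^2. *)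
Definition weak_laplacian Omega f g : Prop :=
  [/\ L2 Omega f, L2 Omega g & forall psi, test_function Omega psi ->
    \int[mu]_(x in Omega) (f x * \sum_(i < d) partial i (partial i psi) x) =
    \int[mu]_(x in Omega) (g x * psi x)].

(* The graph of the operator - Delta + V with domain H^1_0 `&` H^2. *)
Definition dirichlet_op Omega V f g : Prop :=
  [/\ H10 Omega f, H2 Omega f & exists2 lap, weak_laplacian Omega f lap &
    ae_eq_in Omega g (fun x => - lap x + V x * f x)].

Definition eigenfunction Omega V (lambda : R) f : Prop :=
  dirichlet_op Omega V f (fun x => lambda * f x) /\
  ~ ae_eq_in Omega f (fun=> 0).

Definition simple_eigenvalues Omega V : Prop :=
  forall (lambda : R) f g,
    eigenfunction Omega V lambda f -> eigenfunction Omega V lambda g ->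
    exists c : R, ae_eq_in Omega g (fun x => c * f x).

Definition orthonormal_basis Omega (phi : nat -> E -> R) : Prop :=
  [/\ forall j, L2 Omega (phi j),
      forall j k, \int[mu]_(x in Omega) (phi j x * phi k x) = (j == k)%:R &
      forall f, L2 Omega f -> cvg_L2 \oo Omega
        (fun n x => \sum_(j < n) (\int[mu]_(y in Omega) (f y * phi j y)) * phi j x)
        f].

End sobolev.

(* A complex-valued function is in one of the spaces above when its real and
   imaginary parts are. *)
Section schrodinger.
Context {R : realType} {d : nat}.
Local Notation E := 'rV[R]_d.
Local Notation mu := (@lebesgue_rV R d).
Implicit Types (Omega omega : set E) (V : E -> R).

Definition re_part (u : E -> R[i]) : E -> R := fun x => complex.Re (u x).
Definition im_part (u : E -> R[i]) : E -> R := fun x => complex.Im (u x).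

Definition sqmod (z : R[i]) : R := complex.Re z ^+ 2 + complex.Im z ^+ 2.

(* dtu is the derivative of u : R -> L^2(Omega; C). *)
Definition time_derivative Omega (u dtu : R -> E -> R[i]) : Prop :=
  forall t (p : (E -> R[i]) -> E -> R), p = re_part \/ p = im_part ->
    [/\ L2 Omega (p (u t)), L2 Omega (p (dtu t)) &
      cvg_L2 0^' Omega (fun h x => (p (u (t + h)) x - p (u t) x) / h)
        (p (dtu t))].

(* u is a strong solution of i d_t u = Delta u - V u on R x Omega, with initial
   data u(0) in H^1_0 `&` H^2; u = 0 on the boundary of Omega means that u(t) is
   in H^1_0 for all t. Such a u is determined by u(0): if (phi_j) is an
   orthonormal basis of eigenfunctions, then pairing the equation with phi_j
   gives u(t) = \sum_j <u(0), phi_j> exp(i lambda_j t) phi_j. *)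
Definition schrodinger_solution Omega V (u dtu : R -> E -> R[i]) : Prop :=
  [/\ H2 Omega (re_part (u 0)) /\ H2 Omega (im_part (u 0)),
      forall t, H10 Omega (re_part (u t)) /\ H10 Omega (im_part (u t)),
      time_derivative Omega u dtu &
      forall t, exists lap : E -> R[i],
        [/\ weak_laplacian Omega (re_part (u t)) (re_part lap),
            weak_laplacian Omega (im_part (u t)) (im_part lap) &
            ae_eq_in Omega (fun x => 'i%C * dtu t x)
              (fun x => lap x - (V x)%:C%C * u t x)]].

Definition obs_quotient Omega omega (dtu : R -> E -> R[i]) (T : R) : R :=
  T^-1 *
  ((\int[lebesgue_measure]_(t in `[0%R, T]) \int[mu]_(x in omega) sqmod (dtu t x)) /
   \int[mu]_(x in Omega) sqmod (dtu 0 x)).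

(* C_oo^V(chi_omega); the nonvanishing condition says that d_t u(0) is not 0 in
   L^2(Omega), i.e., that the quotient is defined. *)
Definition C_infty Omega V omega : R :=
  inf [set l | exists u dtu : R -> E -> R[i],
    [/\ schrodinger_solution Omega V u dtu,
        \int[mu]_(x in Omega) sqmod (dtu 0 x) != 0 &
        obs_quotient Omega omega dtu T @[T --> +oo] --> l]].

(* J^V(chi_omega); it depends on V through the eigenfunctions phi. *)
Definition J_inf omega (phi : nat -> E -> R) : R :=
  inf (range (fun j => \int[mu]_(x in omega) (phi j x ^+ 2))).

End schrodinger.

(* Main.v *)
Require Import Defs.
From mathcomp Require Import all_boot all_order all_algebra complex.
From mathcomp Require Import all_classical all_reals all_analysis measurable_realfun.
From mathcomp Require Import ring lra.
Set Implicit Arguments.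
Unset Strict Implicit.
Unset Printing Implicit Defensive.
Import Order.TTheory GRing.Theory Num.Theory.
Import numFieldNormedType.Exports.
Local Open Scope classical_set_scope.
Local Open Scope ring_scope.

(** An eigenfunction phi_j evolves as the standing wave exp(i lambda_j t) phi_j,
    whose velocity has modulus |lambda_j phi_j| at every time. Its quotient is
    therefore constant, equal to the integral of phi_j^2 over omega, and the
    infimum over all initial data is at most J
    ([standing_wave_solution], [standing_wave_quotient]).

    Conversely, let u be any solution. The operator - Delta + V is symmetric on
    H^1_0: by [green], which passes Green's formula from test functions to their
    closure, both pairings with a Laplacian equal minus the Dirichlet form. Pairing the
    equation with phi_j then shows that the coefficients p_j, q_j on phi_j of the
    real and imaginary parts of d_t u satisfy
      p_j' = - lambda_j q_j,   q_j' = lambda_j p_j,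
    so that the mode energy e_j = p_j^2 + q_j^2 is constant in time, and by
    Parseval the e_j sum to the squared norm of d_t u at every time
    ([is_derive_velocity], [velocity_parseval]). These two equations replace the
    expansion of u in exponentials.

    Truncate d_t u to the modes j < n. The integral over omega of its squared
    modulus becomes a finite sum of the products p_j p_k + q_j q_k, weighted by
    the integrals of phi_j phi_k over omega. If all eigenvalues are simple, then
    lambda_j <> lambda_k for j <> k, and the product is the derivative of the
    bounded function (q_j p_k - p_j q_k) / (lambda_j - lambda_k): its mean over
    [0, T] tends to 0 ([time_mean_mode_product]). Only the diagonal terms
    survive, and each is at least J e_j. The truncation error is controlled by
    the energy of the modes j >= n, which does not depend on time
    ([truncated_dist]), so it may be added after the limit in T, and n tends to
    infinity last ([observation_lower_bound]). *)

(** * The inner product of square integrable functions *)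

Section L2_theory.
Context {R : realType} {d : nat}.
Local Notation E := 'rV[R]_d.
Local Notation mu := (@lebesgue_rV R d).
Implicit Types (f g h : E -> R).

Definition inner (D : set E) f g : R := \int[mu]_(x in D) (f x * g x).

Variable D : set E.
Hypothesis mD : measurable D.

Lemma L2_integrableM f g : L2 D f -> L2 D g ->
  mu.-integrable D (EFin \o (fun x => f x * g x)).
Proof.
move=> [mf f2] [mg g2].
apply: (le_integrable mD _ _ (integrableD mD f2 g2)) => /=.
  by apply/measurable_EFinP; exact: measurable_funM.
move=> x Dx; rewrite -[leRHS]/(`|(f x ^+ 2 + g x ^+ 2)%:E|%E).
rewrite !abse_EFin lee_fin [leRHS]ger0_norm ?addr_ge0 ?sqr_ge0//.
by rewrite ler_norml; apply/andP; split; nra.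
Qed.

Lemma L2D f g : L2 D f -> L2 D g -> L2 D (fun x => f x + g x).
Proof.
move=> Lf Lg; split; first by apply: measurable_funD; [exact: Lf.1|exact: Lg.1].
apply: (eq_integrable mD ((fun x => (f x ^+ 2)%:E) \+
   (EFin \o (fun x => f x * g x)%R) \+ ((EFin \o (fun x => f x * g x)%R) \+
   (fun x => (g x ^+ 2)%:E)))%E).
  by move=> x _ /=; rewrite -!EFinD; congr (_%:E); ring.
have fg := L2_integrableM Lf Lg.
by apply: integrableD => //; apply: integrableD => //; [exact: Lf.2|exact: Lg.2].
Qed.

Lemma L2Z (c : R) f : L2 D f -> L2 D (fun x => c * f x).
Proof.
move=> [mf f2]; split; first exact: measurable_funM.
apply: (eq_integrable mD (fun x => (c ^+ 2)%:E * (f x ^+ 2)%:E)%E).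
  by move=> x _ /=; rewrite -EFinM; congr (_%:E); ring.
exact: integrableZl.
Qed.

Lemma L2B f g : L2 D f -> L2 D g -> L2 D (fun x => f x - g x).
Proof.
move=> Lf Lg; rewrite (_ : (fun x => _) = (fun x => f x + -1 * g x)).
  by apply: L2D => //; exact: L2Z.
by apply/funext => x; rewrite mulN1r.
Qed.

Lemma L2_sum (J : Type) (s : seq J) (f_ : J -> E -> R) :
  (forall j, L2 D (f_ j)) -> L2 D (fun x => \sum_(j <- s) f_ j x).
Proof.
move=> Lf; elim: s => [|j s ih].
  under eq_fun do rewrite big_nil.
  split=> //; apply: (eq_integrable mD (fun=> 0%:E)); last exact: integrable0.
  by move=> x _; rewrite expr0n.
by under eq_fun do rewrite big_cons; exact: L2D.
Qed.

Lemma L2_subset (A : set E) f : measurable A -> A `<=` D -> L2 D f -> L2 A f.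
Proof.
move=> mA AD [mf f2]; split; first exact: measurable_funS mf.
exact: integrableS f2.
Qed.

Lemma innerC f g : inner D f g = inner D g f.
Proof. by apply: eq_Rintegral => x _; rewrite mulrC. Qed.

Lemma innerDl f g h : L2 D f -> L2 D g -> L2 D h ->
  inner D (fun x => f x + g x) h = inner D f h + inner D g h.
Proof.
move=> Lf Lg Lh; rewrite /inner -RintegralD//; try exact: L2_integrableM.
by apply: eq_Rintegral => x _; rewrite mulrDl.
Qed.

Lemma innerZl c f g : L2 D f -> L2 D g ->
  inner D (fun x => c * f x) g = c * inner D f g.
Proof.
move=> Lf Lg; rewrite /inner -RintegralZl//; last exact: L2_integrableM.
by apply: eq_Rintegral => x _; rewrite mulrA.
Qed.

Lemma innerBl f g h : L2 D f -> L2 D g -> L2 D h ->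
  inner D (fun x => f x - g x) h = inner D f h - inner D g h.
Proof.
move=> Lf Lg Lh; rewrite /inner -RintegralB//; try exact: L2_integrableM.
by apply: eq_Rintegral => x _; rewrite mulrBl.
Qed.

Lemma innerBr f g h : L2 D f -> L2 D g -> L2 D h ->
  inner D h (fun x => f x - g x) = inner D h f - inner D h g.
Proof. by move=> Lf Lg Lh; rewrite innerC innerBl// !(innerC h). Qed.

Lemma innerDr f g h : L2 D f -> L2 D g -> L2 D h ->
  inner D h (fun x => f x + g x) = inner D h f + inner D h g.
Proof. by move=> Lf Lg Lh; rewrite innerC innerDl// !(innerC h). Qed.

Lemma inner_suml (J : Type) (s : seq J) (f_ : J -> E -> R) g :
  (forall j, L2 D (f_ j)) -> L2 D g ->
  inner D (fun x => \sum_(j <- s) f_ j x) g = \sum_(j <- s) inner D (f_ j) g.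
Proof.
move=> Lf Lg; elim: s => [|j s ih].
  rewrite big_nil -[RHS](mul0r (inner D g g)) -innerZl//.
  by apply: eq_Rintegral => x _; rewrite big_nil !mul0r.
rewrite big_cons -ih -innerDl//; last exact: L2_sum.
by apply: eq_Rintegral => x _; rewrite big_cons.
Qed.

Lemma inner_ge0 f : 0 <= inner D f f.
Proof. by apply: Rintegral_ge0 => x _; rewrite -expr2 sqr_ge0. Qed.

Lemma integral_sqrE f : L2 D f ->
  (\int[mu]_(x in D) (f x ^+ 2)%:E)%E = (inner D f f)%:E.
Proof.
move=> Lf; rewrite /inner /Rintegral fineK; last first.
  by apply: integrable_fin_num => //; exact: L2_integrableM.
by apply: eq_integral => x _; rewrite expr2.
Qed.

(** The squared norm of f - s g is a nonnegative quadratic polynomial in s. *)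
Lemma cauchy_schwarz f g : L2 D f -> L2 D g ->
  inner D f g ^+ 2 <= inner D f f * inner D g g.
Proof.
move=> Lf Lg.
have q s : 0 <= inner D f f - 2 * s * inner D f g + s ^+ 2 * inner D g g.
  rewrite (_ : _ + _ = inner D (fun x => f x - s * g x) (fun x => f x - s * g x)).
    exact: inner_ge0.
  have Lsg := L2Z s Lg; have Lfg := L2B Lf Lsg.
  rewrite innerBl// !innerBr// innerZl// (innerC f (fun x => s * _)) !innerZl//.
  rewrite (innerC g (fun x => s * _)) innerZl// (innerC g f); ring.
have [g0|g0] := eqVneq (inner D g g) 0.
  have [->|fg0] := eqVneq (inner D f g) 0; first by rewrite g0 mulr0 expr0n.
  (* The polynomial is affine in s; at this s it would take the value - 1. *)
  have := q ((inner D f f + 1) / (2 * inner D f g)); rewrite g0 mulr0 addr0.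
  rewrite (_ : 2 * _ * _ = inner D f f + 1); first by lra.
  by field.
(* Minimize the polynomial in s. *)
have gp : 0 < inner D g g by rewrite lt_def g0 inner_ge0.
have := q (inner D f g / inner D g g).
rewrite (_ : _ + _ = (inner D f f * inner D g g - inner D f g ^+ 2) / inner D g g).
  by rewrite pmulr_lge0 ?invr_gt0// subr_ge0.
by field.
Qed.

End L2_theory.

Section L2_limits.
Context {R : realType} {d : nat}.
Local Notation E := 'rV[R]_d.
Local Notation mu := (@lebesgue_rV R d).
Implicit Types (f g h : E -> R).
Variable D : set E.
Hypothesis mD : measurable D.
Lemma le_inner_subset (A : set E) f : measurable A -> A `<=` D -> L2 D f ->
  inner A f f <= inner D f f.
Proof.
move=> mA AD Lf; have LA := L2_subset mD mA AD Lf.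
rewrite -lee_fin -!integral_sqrE//; apply: ge0_subset_integral => //.
  by apply/measurable_EFinP; apply: measurable_funX; exact: Lf.1.
by move=> x _; rewrite lee_fin sqr_ge0.
Qed.

Context {I : Type} {F : set_system I} {FF : Filter F}.

Lemma cvg_L2P (f_ : I -> E -> R) f : (forall i, L2 D (f_ i)) -> L2 D f ->
  cvg_L2 F D f_ f <->
  inner D (fun x => f_ i x - f x) (fun x => f_ i x - f x) @[i --> F] --> 0.
Proof.
move=> Lf_ Lf; rewrite /cvg_L2.
rewrite (_ : (fun i => _) = EFin \o (fun i =>
  inner D (fun x => f_ i x - f x) (fun x => f_ i x - f x))); last first.
  by apply/funext => i /=; rewrite integral_sqrE//; exact: L2B.
split => [/fine_cvg//|c0]; apply: cvg_EFin => //.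
by apply: nearW => i.
Qed.

(** Strong convergence implies weak convergence, by the Cauchy-Schwarz
    inequality. *)
Lemma cvg_inner (f_ : I -> E -> R) f g : (forall i, L2 D (f_ i)) -> L2 D f ->
  L2 D g -> cvg_L2 F D f_ f -> inner D (f_ i) g @[i --> F] --> inner D f g.
Proof.
move=> Lf_ Lf Lg /(cvg_L2P Lf_ Lf) cf.
apply/subr_cvg0.
under eq_fun do rewrite -innerBl//.
apply/norm_cvg0P.
under eq_fun do rewrite -sqrtr_sqr.
have c0 : Num.sqrt (inner D (fun x => f_ i x - f x) (fun x => f_ i x - f x) *
    inner D g g) @[i --> F] --> 0.
  have := cvgM cf (cvg_cst (inner D g g)); rewrite mul0r.
  move=> cm; rewrite -[X in _ --> X](@sqrtr0 R).
  by apply: (cvg_comp _ _ (cm FF FF)); exact: sqrt_continuous.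
apply: squeeze_cvgr (cvg_cst 0) c0.
near=> i; rewrite sqrtr_ge0/= ler_wsqrtr// cauchy_schwarz//; exact: L2B.
Unshelve. all: end_near.
Qed.

End L2_limits.

(** * Test functions and Green's formula *)

Section test_functions.
Context {R : realType} {d : nat}.
Local Notation E := 'rV[R]_d.
Local Notation mu := (@lebesgue_rV R d).
Implicit Types (Omega : set E) (f g psi : E -> R).

(** Row vectors carry the sup norm: a ball is a box, of finite measure. *)
Lemma bounded_lebesgue_rV_lty (A : set E) : measurable A -> bounded_set A ->
  (mu A < +oo)%E.
Proof.
move=> mA /ex_strict_bound_gt0[M M0 AM].
pose B := [set x : E | forall i, ball (0 : R) M (x ord0 i)].
have BE : B = ball (0 : E) M.
  rewrite eqEsubset; split=> [x Bx|x [_ Bx] i].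
    apply: (conj M0) => i j; rewrite (ord1 i) mxE; exact: Bx.
  by have := Bx ord0 i; rewrite mxE.
have AB : A `<=` B by move=> x Ax; rewrite BE -ball_normE/= sub0r normrN; exact: AM.
apply: (@le_lt_trans _ _ (mu B)).
  apply: le_measure => //; rewrite inE// BE.
  by apply: open_measurable_rV; exact: ball_open.
rewrite (@lebesgue_rV_box R d (fun=> ball (0 : R) M)); last first.
  by move=> i; apply: open_measurable; exact: ball_open.
rewrite ltey_eq; apply/orP; left.
apply: (@big_ind _ (fun x : \bar R => x \is a fin_num)) => [//|x y|i _].
  exact: fin_numM.
by rewrite lebesgue_measure_ball// ltW.
Qed.

Lemma continuous_measurable_rV f : continuous f -> measurable_fun setT f.
Proof.
move=> cf; apply: (measurability _ (RGenOpens.measurableE R)).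
move=> _ [_ [a [b ->] <-]]; rewrite setTI; apply: open_measurable_rV.
by apply: open_comp => // x _; exact: cf.
Qed.

Lemma test_function_continuous Omega psi : test_function Omega psi -> continuous psi.
Proof. by move=> [sm _] x; apply: differentiable_continuous; exact: (sm [::]). Qed.

Lemma test_function_L2 Omega psi : open Omega -> bounded_set Omega ->
  test_function Omega psi -> L2 Omega psi.
Proof.
move=> oO bO tpsi; have cpsi := test_function_continuous tpsi.
have mO : measurable Omega by exact: open_measurable_rV.
have mpsi : measurable_fun Omega psi.
  by apply: measurable_funTS; exact: continuous_measurable_rV.
split=> //; apply: measurable_bounded_integrable => //.
- exact: bounded_lebesgue_rV_lty.
- exact: (measurable_funX 2 mpsi).
have [_ [K [cK KO psi0]]] := tpsi.
have /compact_bounded/ex_strict_bound_gt0[M M0 KM] : compact (psi @` K).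
  apply: continuous_compact => //; exact: continuous_subspaceT.
exists (M ^+ 2); split=> [|N MN x _ /=]; first exact: num_real.
apply: le_trans (ltW MN).
have psiM : `|psi x| <= M.
  have [Kx|nKx] := pselect (K x); last by rewrite psi0// normr0 ltW.
  by apply: ltW; apply: KM; exists x.
by rewrite normrX lerXn2r// nnegrE// ltW.
Qed.

(** The support does not grow: a point outside the compact, hence closed, set K
    has a neighbourhood on which psi is constantly 0. *)
Lemma test_function_partial Omega psi i : test_function Omega psi ->
  test_function Omega (partial i psi).
Proof.
move=> [sm [K [cK KO psi0]]]; split.
  by move=> s x; rewrite -foldr_rcons; exact: sm.
exists K; split=> // x nKx.
have oK : open (~` K).
  by rewrite openC; apply: compact_closed => //; exact: norm_hausdorff.
rewrite /partial (@near_eq_derive _ _ _ psi (cst 0)) ?derive_cst//.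
have : nbhs x (~` K) by exact: open_nbhs_nbhs.
by apply: filterS => y; exact: psi0.
Qed.

Lemma smoothZ (c : R) f (s : seq 'I_d) : smooth f ->
  foldr partial (fun x => c * f x) s = fun x => c * foldr partial f s x.
Proof.
move=> sf; elim: s => //= i s ->; apply/funext => x.
rewrite /partial -deriveMl//; apply: diff_derivable; exact: sf.
Qed.

Lemma test_functionZ Omega (c : R) psi : test_function Omega psi ->
  test_function Omega (fun x => c * psi x).
Proof.
move=> [sm [K [cK KO psi0]]]; split=> [s x|].
  by rewrite smoothZ//; apply: differentiableZ; exact: sm.
by exists K; split=> // x nKx; rewrite psi0// mulr0.
Qed.

(** First Green formula. For phi = psi n, it compares two integrations by parts:
    both derivatives of the Laplacian of u go to psi n, or one of them stays on u.
    Both sides are continuous for the convergence of psi n and its partial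
    derivatives in L^2. *)
Lemma green Omega u lap phi (gu gphi : 'I_d -> E -> R) (psi : nat -> E -> R) :
  open Omega -> bounded_set Omega ->
  weak_laplacian Omega u lap -> (forall i, weak_partial Omega i u (gu i)) ->
  L2 Omega phi -> (forall i, L2 Omega (gphi i)) ->
  (forall n, test_function Omega (psi n)) ->
  cvg_L2 \oo Omega psi phi ->
  (forall i, cvg_L2 \oo Omega (fun n => partial i (psi n)) (gphi i)) ->
  inner Omega lap phi = - \sum_(i < d) inner Omega (gu i) (gphi i).
Proof.
move=> oO bO [Lu Llap wlap] wgu Lphi Lgphi tpsi cpsi cgpsi.
have mO : measurable Omega by exact: open_measurable_rV.
have Lt psi0 : test_function Omega psi0 -> L2 Omega psi0 by exact: test_function_L2.
have Lgu i : L2 Omega (gu i) by have [] := wgu i.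
have approx n : inner Omega (psi n) lap =
    - \sum_(i < d) inner Omega (partial i (psi n)) (gu i).
  rewrite innerC [LHS]/inner -wlap// -[LHS]/(inner Omega u _) innerC inner_suml//.
    rewrite -sumrN; apply: eq_bigr => i _.
    have [_ _ wp] := wgu i.
    rewrite innerC [LHS]/inner wp; last exact: test_function_partial.
    by rewrite (innerC _ (partial i _)).
  by move=> i; apply: Lt; do 2 apply: test_function_partial.
have cvl : inner Omega (psi n) lap @[n --> \oo] --> inner Omega phi lap.
  by apply: cvg_inner => // n; exact: Lt.
rewrite innerC; apply: cvg_unique cvl _ => //.
rewrite /=; under eq_cvg do rewrite approx.
apply: cvgN; under [X in _ --> X]eq_bigr do rewrite innerC.
apply: cvg_big => [|i _]; first exact: add_continuous.
apply: cvg_inner => // n; apply: Lt.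
exact: test_function_partial.
Qed.

(** Both sides are minus the Dirichlet form of f and g. Each use of Green's formula
    approximates one of the functions by test functions, so both have to be in
    H^1_0. *)
Lemma laplacian_symmetric Omega f g lf lg : open Omega -> bounded_set Omega ->
  H10 Omega f -> H10 Omega g ->
  weak_laplacian Omega f lf -> weak_laplacian Omega g lg ->
  inner Omega lf g = inner Omega lg f.
Proof.
move=> oO bO [Lf [gf [psif [wf tf cf cgf]]]] [Lg [gg [psig [wg tg cg cgg]]]] lapf lapg.
rewrite (green oO bO lapf wf Lg _ tg cg cgg); last by move=> i; have [] := wg i.
rewrite (green oO bO lapg wg Lf _ tf cf cgf); last by move=> i; have [] := wf i.
by congr (- _); apply: eq_bigr => i _; rewrite innerC.
Qed.

End test_functions.

(** * Pairing the equation with an eigenfunction; planar rotations *)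

Section pairing.
Context {R : realType} {d : nat}.
Local Notation E := 'rV[R]_d.
Local Notation mu := (@lebesgue_rV R d).
Implicit Types (Omega : set E) (f g psi : E -> R).

Lemma ae_eq_in_Rintegral (D : set E) f g : measurable D ->
  measurable_fun D f -> measurable_fun D g -> ae_eq_in D f g ->
  \int[mu]_(x in D) f x = \int[mu]_(x in D) g x.
Proof.
move=> mD mf mg fg; congr fine; apply: ae_eq_integral => //.
- exact/measurable_EFinP.
- exact/measurable_EFinP.
- by apply: filterS fg => x fg Dx; rewrite fg.
Qed.

(** The symmetry of - Delta + V. The product V u phi is eliminated pointwise
    between the two equations, so that every integral that remains is that of a
    product of two L^2 functions. *)
Lemma eigenfunction_pairing Omega V (lam : R) phi u lap w :
  open Omega -> bounded_set Omega -> eigenfunction Omega V lam phi ->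
  H10 Omega u -> weak_laplacian Omega u lap -> L2 Omega w ->
  ae_eq_in Omega w (fun x => V x * u x - lap x) ->
  inner Omega w phi = lam * inner Omega u phi.
Proof.
move=> oO bO [[Hphi _ [lphi lapphi ephi]] _] Hu lapu Lw ew.
have mO : measurable Omega by exact: open_measurable_rV.
have [Lu _] := Hu; have [Lphi _] := Hphi.
have [_ Llap _] := lapu; have [_ Llphi _] := lapphi.
apply: (addIr (inner Omega lap phi)).
rewrite {2}(laplacian_symmetric oO bO Hu Hphi lapu lapphi).
have Llu := L2Z mO lam Lu.
rewrite -innerZl// innerC (innerC _ lap) (innerC _ _ phi) (innerC _ lphi).
rewrite /inner -!RintegralD//; try exact: L2_integrableM.
have [mu' _] := Lu; have [mphi _] := Lphi; have [mw _] := Lw.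
have [mlap _] := Llap; have [mlphi _] := Llphi.
apply: ae_eq_in_Rintegral => //.
- by apply: measurable_funD; apply: measurable_funM.
- apply: measurable_funD; apply: measurable_funM => //.
  exact: measurable_funM.
apply: filterS2 ew ephi => x ew ephi Ox.
rewrite (ew Ox); have := ephi Ox => /(congr1 (fun y => u x * y)).
lra.
Qed.

(** Pairing with a fixed g is continuous on L^2, so it commutes with the time
    derivative, which is a limit in L^2. *)
Lemma is_derive_inner Omega (f f' : R -> E -> R) g (t : R) : measurable Omega ->
  (forall s, L2 Omega (f s)) -> L2 Omega (f' t) -> L2 Omega g ->
  cvg_L2 0^' Omega (fun h x => (f (t + h) x - f t x) / h) (f' t) ->
  is_derive t (1 : R) (fun s => inner Omega (f s) g) (inner Omega (f' t) g).
Proof.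
move=> mO Lf Lf' Lg cf.
have Lq h : L2 Omega (fun x => (f (t + h) x - f t x) / h).
  by under eq_fun do rewrite mulrC; apply: L2Z => //; exact: L2B.
have c : h^-1 *: (inner Omega (f (h *: (1 : R) + t)) g - inner Omega (f t) g)
    @[h --> 0^'] --> inner Omega (f' t) g.
  rewrite (_ : (fun h => _) =
      (fun h => inner Omega (fun x => (f (t + h) x - f t x) / h) g)).
    exact: cvg_inner cf.
  apply/funext => h; rewrite [h *: 1]mulr1 (addrC h) -innerBl//.
  rewrite -[LHS]/(h^-1 * _) -innerZl//; last exact: L2B.
  by apply: eq_Rintegral => x _; rewrite (mulrC _ h^-1).
split; first exact: (cvgP _ c).
by apply: cvg_lim => //; exact: c.
Qed.

End pairing.

Section rotation.
Context {R : realType}.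

(** The point (p, q) turns around the origin with angular velocity lam. *)
Lemma rotation_sqr_cst (lam : R) (p q : R -> R) :
  (forall t, is_derive t (1 : R) p (- (lam * q t))) ->
  (forall t, is_derive t (1 : R) q (lam * p t)) ->
  forall s t, p s ^+ 2 + q s ^+ 2 = p t ^+ 2 + q t ^+ 2.
Proof.
move=> dp dq s t.
apply: (@is_derive_0_is_cst R (fun t => p t ^+ 2 + q t ^+ 2)) => {s t} t.
have := dp t; have := dq t => ? ?.
apply: is_derive_eq; rewrite /= /GRing.scale/=; ring.
Qed.

(** The complex numbers z = p + i q and w = r + i s rotate with angular velocities
    l and m, hence the product of z and the conjugate of w rotates with angular
    velocity l - m. Its imaginary part is differentiated here; its real part
    appears in the derivative. *)
Lemma is_derive_cross (l m : R) (p q r s : R -> R) t :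
  is_derive t (1 : R) p (- (l * q t)) -> is_derive t (1 : R) q (l * p t) ->
  is_derive t (1 : R) r (- (m * s t)) -> is_derive t (1 : R) s (m * r t) ->
  is_derive t (1 : R) (fun t => q t * r t - p t * s t)
    ((l - m) * (p t * r t + q t * s t)).
Proof.
move=> dp dq dr ds; apply: is_derive_eq; rewrite /GRing.scale/=; ring.
Qed.

Lemma ler_norm_cross (p q r s : R) :
  `|q * r - p * s| <= p ^+ 2 + q ^+ 2 + (r ^+ 2 + s ^+ 2).
Proof.
have := sqr_ge0 (q - r); have := sqr_ge0 (q + r).
have := sqr_ge0 (p - s); have := sqr_ge0 (p + s).
have := sqr_ge0 p; have := sqr_ge0 q; have := sqr_ge0 r; have := sqr_ge0 s.
by move=> *; rewrite ler_norml; apply/andP; split; lra.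
Qed.

End rotation.

(** * Fourier expansion in an orthonormal basis *)

Section bessel_parseval.
Context {R : realType} {d : nat}.
Local Notation E := 'rV[R]_d.
Local Notation mu := (@lebesgue_rV R d).
Variables (Omega : set E) (phi : nat -> E -> R).
Hypotheses (mO : measurable Omega) (hphi : orthonormal_basis Omega phi).
Implicit Types (f g : E -> R).

Definition fourier f (j : nat) : R := inner Omega f (phi j).

Definition fourier_sum f n : E -> R :=
  fun x => \sum_(j < n) fourier f j * phi j x.

Lemma inner_fourier_sum (A : set E) f g n : measurable A -> A `<=` Omega ->
  L2 A g ->
  inner A (fourier_sum f n) g = \sum_(j < n) fourier f j * inner A (phi j) g.
Proof.
move=> mA AO Lg; have [Lphi _ _] := hphi.
have LA j : L2 A (phi j) by exact: L2_subset AO (Lphi j).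
rewrite /fourier_sum inner_suml//; last by move=> j; exact: L2Z.
by apply: eq_bigr => j _; rewrite innerZl.
Qed.

Lemma L2_fourier_sum f n : L2 Omega (fourier_sum f n).
Proof. by have [Lphi _ _] := hphi; apply: L2_sum => // j; exact: L2Z. Qed.

Lemma inner_fourier_sum_phi f n (k : nat) : (k < n)%N ->
  inner Omega (fourier_sum f n) (phi k) = fourier f k.
Proof.
move=> kn; have [Lphi ortho _] := hphi.
rewrite inner_fourier_sum// (bigD1 (Ordinal kn))//= big1 ?addr0.
  by rewrite [inner _ _ _]ortho eqxx mulr1.
by move=> j jk; rewrite [inner _ _ _]ortho (negbTE jk : (j == k :> nat) = false) mulr0.
Qed.

Lemma inner_fourier_sum_self f n : L2 Omega f ->
  inner Omega (fourier_sum f n) f = \sum_(j < n) fourier f j ^+ 2.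
Proof.
by move=> Lf; rewrite inner_fourier_sum//; apply: eq_bigr => j _; rewrite innerC.
Qed.

Lemma fourier_sum_norm f n : L2 Omega f ->
  inner Omega (fourier_sum f n) (fourier_sum f n) =
  \sum_(j < n) fourier f j ^+ 2.
Proof.
move=> Lf; rewrite inner_fourier_sum//; last exact: L2_fourier_sum.
by apply: eq_bigr => j _; rewrite innerC inner_fourier_sum_phi.
Qed.

(** Pythagoras: the partial sum is the orthogonal projection of f. *)
Lemma fourier_residual f n : L2 Omega f ->
  inner Omega (fun x => f x - fourier_sum f n x) (fun x => f x - fourier_sum f n x)
  = inner Omega f f - \sum_(j < n) fourier f j ^+ 2.
Proof.
move=> Lf; have LS := L2_fourier_sum f n.
rewrite innerBl//; last exact: L2B.
rewrite !innerBr// fourier_sum_norm// innerC inner_fourier_sum_self//; ring.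
Qed.

Lemma bessel f n : L2 Omega f ->
  \sum_(j < n) fourier f j ^+ 2 <= inner Omega f f.
Proof. by move=> Lf; rewrite -subr_ge0 -fourier_residual// inner_ge0. Qed.

Lemma parseval f : L2 Omega f ->
  \sum_(j < n) fourier f j ^+ 2 @[n --> \oo] --> inner Omega f f.
Proof.
move=> Lf; have [_ _ /(_ f Lf)] := hphi.
move=> /(cvg_L2P mO (fun n => L2_fourier_sum f n) Lf) => c.
have : inner Omega f f - \sum_(j < n) fourier f j ^+ 2 @[n --> \oo] --> 0.
  apply: cvg_trans c; apply: near_eq_cvg; apply: nearW => n.
  rewrite -fourier_residual//; apply: eq_Rintegral => x _.
  ring.
move=> /(cvgB (cvg_cst (inner Omega f f))); rewrite subr0.
by under eq_cvg do rewrite /= subKr.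
Qed.

(** Factor the difference of squares and apply the Cauchy-Schwarz inequality on A.
    Both factors are then bounded by norms on Omega: the first one is the residual,
    and the second one is at most twice the norm of f by Bessel's inequality. *)
Lemma inner_fourier_sum_dist (A : set E) f n : measurable A -> A `<=` Omega ->
  L2 Omega f ->
  `|inner A f f - inner A (fourier_sum f n) (fourier_sum f n)| <=
  2 * Num.sqrt (inner Omega f f *
    (inner Omega f f - \sum_(j < n) fourier f j ^+ 2)).
Proof.
move=> mA AO Lf; have LS := L2_fourier_sum f n; set S := fourier_sum f n in LS *.
have LfA := L2_subset mO mA AO Lf; have LSA := L2_subset mO mA AO LS.
have LmA := L2B mA LfA LSA; have LpA := L2D mA LfA LSA.
have diff : inner A f f - inner A S S =
    inner A (fun x => f x - S x) (fun x => f x + S x).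
  by rewrite innerBl// !innerDr// (innerC _ S f); ring.
have plus : inner A (fun x => f x + S x) (fun x => f x + S x) <=
    4 * inner Omega f f.
  apply: (le_trans (le_inner_subset mO mA AO (L2D mO Lf LS))).
  rewrite innerDl//; last exact: L2D.
  rewrite !innerDr//.
  rewrite fourier_sum_norm// (innerC _ f S) inner_fourier_sum_self//.
  by have := bessel n Lf; lra.
rewrite diff -sqrtr_sqr.
apply: (@le_trans _ _ (Num.sqrt (inner A (fun x => f x - S x) (fun x => f x - S x)
    * inner A (fun x => f x + S x) (fun x => f x + S x)))).
  by apply: ler_wsqrtr; exact: cauchy_schwarz.
have -> : 2 = Num.sqrt (2 ^+ 2) :> R by rewrite sqrtr_sqr ger0_norm.
rewrite -sqrtrM ?sqr_ge0//; apply: ler_wsqrtr.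
rewrite (_ : 2 ^+ 2 * _ = (inner Omega f f - \sum_(j < n) fourier f j ^+ 2) *
   (4 * inner Omega f f)); last by ring.
apply: ler_pM => //; try exact: inner_ge0.
rewrite -fourier_residual//.
by apply: le_inner_subset => //; exact: L2B.
Qed.

End bessel_parseval.

(** * Means over long times *)

Section time_average.
Context {R : realType}.
Implicit Types (f g F : R -> R) (m : R).
Local Notation leb := (@lebesgue_measure R).

(** Integrability is part of the notion because the integral of a function that is
    not integrable has a conventional value, for which additivity fails. *)
Definition time_mean f m : Prop :=
  (forall T : R, leb.-integrable `[0, T] (EFin \o f)) /\
  T^-1 * \int[leb]_(t in `[0, T]) f t @[T --> +oo] --> m.

Let mI (T : R) : measurable (`[0, T] : set (measurableTypeR R)).
Proof. exact: measurable_itv. Qed.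

Lemma is_derive_continuous F f : (forall t, is_derive t (1 : R) F (f t)) ->
  continuous F.
Proof.
move=> dF t; apply: differentiable_continuous; apply/derivable1_diffP.
by have [] := dF t.
Qed.

Lemma continuous_integrable_itv f (T : R) : continuous f ->
  leb.-integrable `[0, T] (EFin \o f).
Proof.
move=> cf; apply: continuous_compact_integrable; first exact: segment_compact.
exact: continuous_subspaceT.
Qed.

Lemma Rintegral_cst_itv (c T : R) : 0 <= T -> \int[leb]_(t in `[0, T]) c = c * T.
Proof.
rewrite le_eqVlt Rintegral_cst//= lebesgue_measure_itv/= lte_fin.
by move=> /predU1P[<-|->]; rewrite ?ltxx ?sube0.
Qed.

Lemma time_mean_cst m : time_mean (fun=> m) m.
Proof.
split=> [T|]; first by apply: continuous_integrable_itv; exact: cst_continuous.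
apply: cvg_near_cst; near=> T.
have T0 : 0 < T by near: T; exact: nbhs_pinfty_gt.
by rewrite Rintegral_cst_itv ?ltW// mulrCA mulVf ?mulr1// gt_eqF.
Unshelve. all: end_near. Qed.

Lemma time_meanZ (c : R) f m : time_mean f m -> time_mean (fun t => c * f t) (c * m).
Proof.
move=> [intf cf]; split=> [T|].
  apply: (eq_integrable (mI T) (fun x => c%:E * (f x)%:E)%E) => //.
  by apply: integrableZl => //; exact: intf.
rewrite (_ : (fun T => _) =
    (fun T => c * (T^-1 * \int[leb]_(t in `[0, T]) f t))).
  exact: (cvgM (cvg_cst c) cf).
by apply/funext => T; rewrite RintegralZl// mulrCA.
Qed.

Lemma time_meanD f g m n : time_mean f m -> time_mean g n ->
  time_mean (fun t => f t + g t) (m + n).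
Proof.
move=> [intf cf] [intg cg]; split=> [T|].
  apply: (eq_integrable (mI T) ((EFin \o f) \+ (EFin \o g))%E) => //.
  by apply: integrableD; [exact: mI|exact: intf|exact: intg].
rewrite (_ : (fun T => _) =
    (fun T => T^-1 * \int[leb]_(t in `[0, T]) f t +
              T^-1 * \int[leb]_(t in `[0, T]) g t)).
  exact: cvgD.
apply/funext => T.
by rewrite RintegralD// mulrDr.
Qed.

Lemma time_mean_sum (J : Type) (s : seq J) (f_ : J -> R -> R) (m_ : J -> R) :
  (forall j, time_mean (f_ j) (m_ j)) ->
  time_mean (fun t => \sum_(j <- s) f_ j t) (\sum_(j <- s) m_ j).
Proof.
move=> H; elim: s => [|j s ih].
  by under eq_fun do rewrite big_nil; rewrite big_nil; exact: time_mean_cst.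
under eq_fun do rewrite big_cons.
by rewrite big_cons; exact: time_meanD.
Qed.

(** The integral over [0, T] is F T - F 0, which is bounded, and it is divided
    by T. *)
Lemma time_mean_derive f F (C : R) : continuous f ->
  (forall t, is_derive t (1 : R) F (f t)) -> (forall t, `|F t| <= C) ->
  time_mean f 0.
Proof.
move=> cf dF FC; split=> [T|]; first exact: continuous_integrable_itv.
have cF := is_derive_continuous dF.
have ftc (T : R) : 0 < T -> \int[leb]_(t in `[0, T]) f t = F T - F 0.
  move=> T0; rewrite /Rintegral (@continuous_FTC2 _ f F)//=.
  - exact: continuous_subspaceT.
  - split=> [x _||]; first by have [] := dF x.
    + by apply: cvg_at_right_filter; exact: cF.
    + by apply: cvg_at_left_filter; exact: cF.
  - by move=> x _; rewrite derive1E; have [_ ->] := dF x.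
apply/norm_cvg0P.
have c0 : T^-1 * (C + C) @[T --> +oo] --> (0 : R).
  rewrite -[X in _ --> X](mul0r (C + C)); apply: cvgM; last exact: cvg_cst.
  apply/gtr0_cvgV0; last exact: cvg_id.
  exact: nbhs_pinfty_gt.
apply: squeeze_cvgr (cvg_cst 0) c0; near=> T.
have T0 : 0 < T by near: T; exact: nbhs_pinfty_gt.
rewrite normr_ge0/= ftc// normrM ger0_norm ?invr_ge0 ?(ltW T0)//.
rewrite ler_wpM2l ?invr_ge0 ?(ltW T0)//.
by apply: (le_trans (ler_normB _ _)); exact: lerD.
Unshelve. all: end_near. Qed.

(** A bound that is uniform in time passes to the averages over [0, T], hence to
    their limits. The bound for all n also makes f a pointwise limit of the g n,
    which is where its measurability comes from. *)
Lemma time_mean_uniform_limit f (g : nat -> R -> R) (m eps : nat -> R) (L : R) :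
  (forall n, time_mean (g n) (m n)) ->
  (forall n t, `|f t - g n t| <= eps n) -> eps @ \oo --> 0 ->
  T^-1 * \int[leb]_(t in `[0, T]) f t @[T --> +oo] --> L ->
  forall n, m n - eps n <= L.
Proof.
move=> Hg fg eps0 cf n.
have intf T : leb.-integrable `[0, T] (EFin \o f).
  have mf : measurable_fun (`[0, T] : set R) f.
    apply: (measurable_fun_cvg (h := g)).
      by move=> k; apply/measurable_EFinP; exact: measurable_int ((Hg k).1 T).
    move=> t _; apply/cvgrPdist_le => e e0.
    apply: filterS (cvgr_le _ eps0 _ e0) => k.
    exact: le_trans.
  have intg := (Hg 0%N).1 T.
  have inte := continuous_integrable_itv T (@cst_continuous R R (eps 0%N)).
  apply: (le_integrable (mI T) _ _
    (integrableD (mI T) (integrable_norm intg) inte)).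
    exact/measurable_EFinP.
  move=> t _ /=; rewrite lee_fin.
  apply: le_trans (ler_norm _); rewrite -lerBlDl.
  by apply: le_trans (fg 0%N t); exact: lerB_dist.
have mean : T^-1 * \int[leb]_(t in `[0, T]) (g n t + - eps n) @[T --> +oo] -->
    m n - eps n by exact: (time_meanD (Hg n) (time_mean_cst _)).2.
apply: ler_cvg_to mean cf _; near=> T.
have T0 : 0 < T by near: T; exact: nbhs_pinfty_gt.
rewrite ler_wpM2l ?invr_ge0 ?(ltW T0)//.
apply: le_Rintegral => //.
  exact: (time_meanD (Hg n) (time_mean_cst _)).1.
move=> t _; rewrite lerBlDr -lerBlDl.
by apply: le_trans (fg n t); rewrite distrC ler_norm.
Unshelve. all: end_near. Qed.

End time_average.

(** * The lower bound for an arbitrary solution *)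

Section asymptotic_lower_bound.
Context {R : realType} {d : nat}.
Local Notation E := 'rV[R]_d.
Local Notation mu := (@lebesgue_rV R d).
Variables (Omega : set E) (V : E -> R) (lambda : nat -> R) (phi : nat -> E -> R).
Hypotheses (oO : open Omega) (bO : bounded_set Omega).
Hypotheses (hphi : orthonormal_basis Omega phi)
  (heigen : forall j, eigenfunction Omega V (lambda j) (phi j)).

Local Notation coef := (fourier Omega phi).

Let mO : measurable Omega. Proof. exact: open_measurable_rV. Qed.

(** If lambda j = lambda k, then phi j and phi k are proportional; orthogonal unit
    vectors are not. *)
Lemma simple_eigenvalues_inj : simple_eigenvalues Omega V -> injective lambda.
Proof.
move=> simp j k ljk; apply/eqP; apply: contraT => jk.
have [Lphi ortho _] := hphi.
have [c ek] : exists c : R, ae_eq_in Omega (phi k) (fun x => c * phi j x).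
  by apply: (simp (lambda j)) => //; rewrite ljk.
have pair g : L2 Omega g -> inner Omega (phi k) g = c * inner Omega (phi j) g.
  move=> Lg; rewrite -innerZl//; apply: ae_eq_in_Rintegral => //.
  - by apply: measurable_funM; [exact: (Lphi k).1|exact: Lg.1].
  - by apply: measurable_funM; [exact: (L2Z mO c (Lphi j)).1|exact: Lg.1].
  - by apply: filterS ek => x ek Ox; rewrite ek.
have := pair _ (Lphi k); rewrite ![inner _ _ _]ortho eqxx (negbTE jk) mulr0.
by move/eqP; rewrite oner_eq0.
Qed.

Section solution.
Variables u dtu : R -> E -> R[i].
Hypothesis hu : schrodinger_solution Omega V u dtu.

Lemma solution_L2 t : [/\ L2 Omega (re_part (u t)), L2 Omega (im_part (u t)),
  L2 Omega (re_part (dtu t)) & L2 Omega (im_part (dtu t))].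
Proof.
have [_ _ td _] := hu.
have [Lru Lrd _] := td t _ (or_introl erefl).
by have [Liu Lid _] := td t _ (or_intror erefl).
Qed.

(** The imaginary and real parts of i d_t u are the real part of d_t u and minus
    its imaginary part: pairing the equation with phi j couples the two parts. *)
Lemma solution_pairing j t :
  coef (im_part (dtu t)) j = lambda j * coef (re_part (u t)) j /\
  coef (re_part (dtu t)) j = - (lambda j * coef (im_part (u t)) j).
Proof.
have [_ hH10 _ /(_ t)[lap [lapr lapi eqn]]] := hu.
have [Hr Hi] := hH10 t; have [Lru Liu Lrd Lid] := solution_L2 t.
split.
  apply: eigenfunction_pairing (heigen j) Hr lapr Lid _ => //.
  apply: filterS eqn => x eqn Ox; have /(congr1 (@complex.Re R)) := eqn Ox.
  rewrite /im_part /re_part /=.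
  by case: (dtu t x) (u t x) (lap x) => [a b] [a' b'] [a2 b2] /=; lra.
rewrite -(eigenfunction_pairing (w := fun x => -1 * re_part (dtu t) x) oO bO
  (heigen j) Hi lapi (L2Z mO _ Lrd)).
  by have [Lphi _ _] := hphi; rewrite innerZl// mulN1r opprK.
apply: filterS eqn => x eqn Ox; have /(congr1 (@complex.Im R)) := eqn Ox.
rewrite /im_part /re_part /=.
by case: (dtu t x) (u t x) (lap x) => [a b] [a' b'] [a2 b2] /=; lra.
Qed.

Let p j t := coef (re_part (dtu t)) j.
Let q j t := coef (im_part (dtu t)) j.

(** Nothing is assumed about the differentiability of d_t u, but its coefficients
    are, by the pairing above, multiples of those of u. *)
Lemma is_derive_velocity j t :
  is_derive t (1 : R) (p j) (- (lambda j * q j t)) /\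
  is_derive t (1 : R) (q j) (lambda j * p j t).
Proof.
have [_ _ td _] := hu; have [Lphi _ _] := hphi.
have da : is_derive t (1 : R) (fun s => coef (re_part (u s)) j) (p j t).
  have [_ Lrd cv] := td t _ (or_introl erefl).
  apply: (is_derive_inner (f := fun s => re_part (u s))
    (f' := fun s => re_part (dtu s)) mO _ Lrd (Lphi j) cv) => s.
  by have [] := solution_L2 s.
have db : is_derive t (1 : R) (fun s => coef (im_part (u s)) j) (q j t).
  have [_ Lid cv] := td t _ (or_intror erefl).
  apply: (is_derive_inner (f := fun s => im_part (u s))
    (f' := fun s => im_part (dtu s)) mO _ Lid (Lphi j) cv) => s.
  by have [] := solution_L2 s.
have -> : p j = fun s => - (lambda j * coef (im_part (u s)) j).
  by apply/funext => s; have [] := solution_pairing j s.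
have -> : q j = fun s => lambda j * coef (re_part (u s)) j.
  by apply/funext => s; have [] := solution_pairing j s.
have [qE pE] := solution_pairing j t.
by split; apply: is_derive_eq; rewrite /GRing.scale/= /p /q ?pE ?qE; ring.
Qed.

Definition mode_energy j : R := p j 0 ^+ 2 + q j 0 ^+ 2.

Lemma mode_energy_cst j t : p j t ^+ 2 + q j t ^+ 2 = mode_energy j.
Proof.
exact: (rotation_sqr_cst (fun s => (is_derive_velocity j s).1)
  (fun s => (is_derive_velocity j s).2)).
Qed.

Lemma integral_sqmod (A : set E) t : measurable A -> A `<=` Omega ->
  \int[mu]_(x in A) sqmod (dtu t x) =
  inner A (re_part (dtu t)) (re_part (dtu t)) +
  inner A (im_part (dtu t)) (im_part (dtu t)).
Proof.
move=> mA AO; have [_ _ Lr Li] := solution_L2 t.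
have LrA := L2_subset mO mA AO Lr; have LiA := L2_subset mO mA AO Li.
by rewrite /inner -RintegralD//; exact: L2_integrableM.
Qed.

Lemma velocity_parseval t : \sum_(j < n) mode_energy j @[n --> \oo] -->
  \int[mu]_(x in Omega) sqmod (dtu t x).
Proof.
have [_ _ Lr Li] := solution_L2 t.
rewrite integral_sqmod//.
rewrite (_ : (fun n => _) = fun n =>
    \sum_(j < n) p j t ^+ 2 + \sum_(j < n) q j t ^+ 2).
  exact: cvgD (parseval mO hphi Lr) (parseval mO hphi Li).
apply/funext => n; rewrite -big_split; apply: eq_bigr => j _.
by rewrite /= (mode_energy_cst j t).
Qed.

Definition energy := \int[mu]_(x in Omega) sqmod (dtu 0 x).

(** Parseval expresses the energy at time t by the mode energies, which do not
    depend on t. *)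
Lemma energy_conservation t : \int[mu]_(x in Omega) sqmod (dtu t x) = energy.
Proof.
exact: (cvg_unique (@Rhausdorff R) (@velocity_parseval t) (@velocity_parseval 0)).
Qed.

Section observation.
Variable omega : set E.
Hypotheses (mo : measurable omega) (oOmega : omega `<=` Omega).

Let truncated n t :=
  inner omega (fourier_sum Omega phi (re_part (dtu t)) n)
              (fourier_sum Omega phi (re_part (dtu t)) n) +
  inner omega (fourier_sum Omega phi (im_part (dtu t)) n)
              (fourier_sum Omega phi (im_part (dtu t)) n).

(* The factor 4 is twice the factor 2 of the estimate for a real function, used
   for the real and for the imaginary part. *)
Let truncation_error n :=
  4 * Num.sqrt (energy * (energy - \sum_(j < n) mode_energy j)).

(** The residual of d_t u at any time is the energy of the modes j >= n, since the
    energy of each mode is conserved. This makes the bound uniform in t. *)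
Lemma truncated_dist n t :
  `|\int[mu]_(x in omega) sqmod (dtu t x) - truncated n t| <= truncation_error n.
Proof.
have [_ _ Lr Li] := solution_L2 t.
rewrite integral_sqmod// /truncated opprD addrACA.
have := energy_conservation t; rewrite integral_sqmod// => en.
have sumE : \sum_(j < n) mode_energy j =
    \sum_(j < n) p j t ^+ 2 + \sum_(j < n) q j t ^+ 2.
  by rewrite -big_split/=; apply: eq_bigr => j _; rewrite (mode_energy_cst j t).
have br := bessel mO hphi n Lr; have bi := bessel mO hphi n Li.
have nr := inner_ge0 Omega (re_part (dtu t)).
have ni := inner_ge0 Omega (im_part (dtu t)).
have root f : L2 Omega f -> inner Omega f f <= energy ->
    inner Omega f f - \sum_(j < n) coef f j ^+ 2 <=
      energy - \sum_(j < n) mode_energy j ->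
    `|inner omega f f - inner omega (fourier_sum Omega phi f n)
      (fourier_sum Omega phi f n)| <=
    2 * Num.sqrt (energy * (energy - \sum_(j < n) mode_energy j)).
  move=> Lf f1 f2; apply: (le_trans (inner_fourier_sum_dist mO hphi n mo oOmega Lf)).
  rewrite ler_pM2l//; apply: ler_wsqrtr; apply: ler_pM => //.
    exact: inner_ge0.
  by rewrite subr_ge0 bessel.
rewrite /truncation_error (_ : 4 = 2 + 2) ?[(2 + 2) * _]mulrDl; last by ring.
apply: (le_trans (ler_normD _ _)).
apply: lerD; apply: root => //.
- by rewrite -en lerDl.
- by rewrite -en sumE -/(p _ t); move: bi; rewrite -/(q _ t); lra.
- by rewrite -en lerDr.
- by rewrite -en sumE; move: br; lra.
Qed.

Lemma truncation_error_cvg0 : truncation_error @ \oo --> 0.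
Proof.
have c : energy * (energy - \sum_(j < n) mode_energy j) @[n --> \oo] --> 0.
  rewrite -[X in _ --> X](mulr0 energy) -[X in energy * X](subrr energy).
  apply: cvgM; first exact: cvg_cst.
  by apply: cvgB; [exact: cvg_cst|exact: velocity_parseval].
rewrite -[X in _ --> X](mulr0 4); apply: cvgM; first exact: cvg_cst.
rewrite -[X in _ --> X](@sqrtr0 R).
by apply: (cvg_comp _ _ c); exact: sqrt_continuous.
Qed.

(** Off the diagonal, the product is the derivative of a bounded function, which
    exists only because lambda j and lambda k differ. *)
Lemma time_mean_mode_product j k : injective lambda ->
  time_mean (fun t => p j t * p k t + q j t * q k t)
    (if j == k then mode_energy j else 0).
Proof.
move=> linj; have [<-|jk] := eqVneq j k.
  under eq_fun do rewrite -!expr2 mode_energy_cst.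
  exact: time_mean_cst.
have ljk : lambda j - lambda k != 0.
  by rewrite subr_eq0; apply: contra jk => /eqP/linj ->.
pose F t := (lambda j - lambda k)^-1 * (q j t * p k t - p j t * q k t).
have cp m : continuous (p m).
  exact: is_derive_continuous (fun t => (is_derive_velocity m t).1).
have cq m : continuous (q m).
  exact: is_derive_continuous (fun t => (is_derive_velocity m t).2).
have cz : continuous (fun t => p j t * p k t + q j t * q k t).
  by move=> t; apply: cvgD; apply: cvgM; [exact: cp|exact: cp|exact: cq|exact: cq].
have dF t : is_derive t (1 : R) F (p j t * p k t + q j t * q k t).
  have dw := is_derive_cross (is_derive_velocity j t).1 (is_derive_velocity j t).2
    (is_derive_velocity k t).1 (is_derive_velocity k t).2.
  apply: (is_derive_eq (is_deriveZ (lambda j - lambda k)^-1 dw)).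
  by rewrite -[LHS]/(_ * _) mulKf.
have FC t : `|F t| <= `|(lambda j - lambda k)^-1| * (mode_energy j + mode_energy k).
  rewrite normrM ler_wpM2l// -(mode_energy_cst j t) -(mode_energy_cst k t).
  exact: ler_norm_cross.
exact: time_mean_derive cz dF FC.
Qed.

Lemma time_mean_truncated n : injective lambda ->
  time_mean (truncated n)
    (\sum_(j < n) inner omega (phi j) (phi j) * mode_energy j).
Proof.
move=> linj; have [Lphi _ _] := hphi.
have Lo j : L2 omega (phi j) by exact: L2_subset oOmega (Lphi j).
have -> : truncated n = fun t => \sum_(j < n) \sum_(k < n)
    inner omega (phi k) (phi j) * (p j t * p k t + q j t * q k t).
  apply/funext => t; rewrite /truncated.
  have LS f : L2 omega (fourier_sum Omega phi f n).
    by apply: L2_subset oOmega _ => //; exact: L2_fourier_sum.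
  rewrite !inner_fourier_sum// -big_split/=; apply: eq_bigr => j _.
  rewrite ![inner _ (phi j) _]innerC !inner_fourier_sum// !mulr_sumr -big_split/=.
  by apply: eq_bigr => k _; rewrite /p /q; ring.
have -> : \sum_(j < n) inner omega (phi j) (phi j) * mode_energy j =
    \sum_(j < n) \sum_(k < n) inner omega (phi k) (phi j) *
      (if (j : nat) == k then mode_energy j else 0).
  apply: eq_bigr => j _; rewrite (bigD1 j)//= eqxx big1 ?addr0// => k kj.
  by rewrite eq_sym (negbTE kj : (k == j :> nat) = false) mulr0.
apply: time_mean_sum => j; apply: time_mean_sum => k.
by apply: time_meanZ; exact: time_mean_mode_product.
Qed.

(** The quotient times the energy has a limit at least
      J * (sum of the mode energies for j < n) - truncation_error n
    for every n, and this tends to J * energy. *)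
Lemma observation_lower_bound (l : R) : injective lambda -> energy != 0 ->
  obs_quotient Omega omega dtu T @[T --> +oo] --> l -> J_inf omega phi <= l.
Proof.
move=> linj en0 cl.
have enp : 0 < energy.
  rewrite lt_def en0; apply: Rintegral_ge0 => x _.
  by rewrite addr_ge0// sqr_ge0.
have Jle j : J_inf omega phi <= inner omega (phi j) (phi j).
  apply: ge_inf.
    by exists 0 => _ [k _ <-]; apply: Rintegral_ge0 => x _; rewrite sqr_ge0.
  by exists j => //; apply: eq_Rintegral => x _; rewrite -expr2.
have ej j : 0 <= mode_energy j by rewrite addr_ge0// sqr_ge0.
have clE : T^-1 * \int[lebesgue_measure]_(t in `[0, T])
    \int[mu]_(x in omega) sqmod (dtu t x) @[T --> +oo] --> l * energy.
  rewrite (_ : (fun T => _) =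
      fun T => obs_quotient Omega omega dtu T * energy).
    exact: cvgM cl (cvg_cst energy).
  apply/funext => T; rewrite /obs_quotient -/energy.
  by rewrite -!mulrA mulVf// mulr1.
rewrite -(ler_pM2r enp).
have low n : J_inf omega phi * (\sum_(j < n) mode_energy j) - truncation_error n
    <= l * energy.
  apply: le_trans (time_mean_uniform_limit (fun n => time_mean_truncated n linj)
    truncated_dist truncation_error_cvg0 clE n).
  rewrite lerD2r mulr_sumr; apply: ler_sum => j _.
  by rewrite ler_wpM2r.
have clow : J_inf omega phi * (\sum_(j < n) mode_energy j) - truncation_error n
    @[n --> \oo] --> J_inf omega phi * energy - 0.
  apply: cvgB truncation_error_cvg0; apply: cvgM; first exact: cvg_cst.
  exact: velocity_parseval.
rewrite -[leLHS]subr0.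
by apply: ler_cvg_to clow (cvg_cst _) _; exact: nearW.
Qed.

End observation.
End solution.
End asymptotic_lower_bound.

(** * Scaling of the function spaces and standing waves *)

Section scaling.
Context {R : realType} {d : nat}.
Local Notation E := 'rV[R]_d.
Local Notation mu := (@lebesgue_rV R d).
Variable Omega : set E.
Hypotheses (oO : open Omega) (bO : bounded_set Omega).
Implicit Types (f g psi : E -> R) (c : R).

Let mO : measurable Omega. Proof. exact: open_measurable_rV. Qed.

Lemma cvg_L2_scale (I : Type) (F : set_system I) (FF : Filter F) (k : I -> R) c f :
  L2 Omega f -> k @ F --> c ->
  cvg_L2 F Omega (fun i x => k i * f x) (fun x => c * f x).
Proof.
move=> Lf kc; apply/cvg_L2P => //; [by move=> i; exact: L2Z|exact: L2Z|].
have L i : L2 Omega (fun x => (k i - c) * f x) by exact: L2Z.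
rewrite (_ : (fun i => _) = fun i => (k i - c) * ((k i - c) * inner Omega f f)).
  rewrite -[X in _ --> X](mul0r (0 * inner Omega f f)).
  have kc0 : k i - c @[i --> F] --> 0 by apply/subr_cvg0.
  by apply: cvgM => //; apply: cvgM => //; exact: cvg_cst.
apply/funext => i; rewrite -[in RHS]innerZl// [in RHS]innerC -[in RHS]innerZl//.
by apply: eq_Rintegral => x _; rewrite -mulrBl.
Qed.

Lemma cvg_L2Z (I : Type) (F : set_system I) (FF : Filter F) (f_ : I -> E -> R) c f :
  (forall i, L2 Omega (f_ i)) -> L2 Omega f -> cvg_L2 F Omega f_ f ->
  cvg_L2 F Omega (fun i x => c * f_ i x) (fun x => c * f x).
Proof.
move=> Lf_ Lf /(cvg_L2P mO Lf_ Lf) cf.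
apply/cvg_L2P => //; [by move=> i; exact: L2Z|exact: L2Z|].
have L i : L2 Omega (fun x => f_ i x - f x) by exact: L2B.
rewrite (_ : (fun i => _) = fun i => c * (c *
    inner Omega (fun x => f_ i x - f x) (fun x => f_ i x - f x))).
  rewrite -[X in _ --> X](mulr0 c) -[X in c * X](mulr0 c).
  by do 2 (apply: cvgM; first exact: cvg_cst).
apply/funext => i; rewrite -[in RHS]innerZl// [in RHS]innerC.
rewrite -[in RHS]innerZl//; last exact: L2Z.
by apply: eq_Rintegral => x _; rewrite -mulrBr.
Qed.

Lemma weak_partialZ i c f g : weak_partial Omega i f g ->
  weak_partial Omega i (fun x => c * f x) (fun x => c * g x).
Proof.
move=> [Lf Lg w]; split; [exact: L2Z|exact: L2Z|move=> psi tpsi].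
have := innerZl mO c Lf (test_function_L2 oO bO (test_function_partial i tpsi)).
have := innerZl mO c Lg (test_function_L2 oO bO tpsi).
rewrite /inner => -> ->; rewrite w//; ring.
Qed.

Lemma H1Z c f : H1 Omega f -> H1 Omega (fun x => c * f x).
Proof.
move=> [Lf w]; split=> [|i]; first exact: L2Z.
by have [g wg] := w i; exists (fun x => c * g x); exact: weak_partialZ.
Qed.

Lemma H2Z c f : H2 Omega f -> H2 Omega (fun x => c * f x).
Proof.
move=> [Lf w]; split=> [|i]; first exact: L2Z.
have [g wg Hg] := w i.
by exists (fun x => c * g x); [exact: weak_partialZ|exact: H1Z].
Qed.

Lemma H10Z c f : H10 Omega f -> H10 Omega (fun x => c * f x).
Proof.
move=> [Lf [grad [psi [w t cf cg]]]]; split; first exact: L2Z.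
have Lt g : test_function Omega g -> L2 Omega g by exact: test_function_L2.
exists (fun i x => c * grad i x), (fun n x => c * psi n x); split.
- by move=> i; exact: weak_partialZ.
- by move=> n; exact: test_functionZ.
- by apply: cvg_L2Z => // n; exact: Lt.
- move=> i; have [_ Lg _] := w i.
  rewrite (_ : (fun n => _) = (fun n x => c * partial i (psi n) x)).
    apply: cvg_L2Z => // n; apply: Lt; exact: test_function_partial.
  by apply/funext => n; exact: (smoothZ c [:: i] (t n).1).
Qed.

Lemma weak_laplacianZ c f g : weak_laplacian Omega f g ->
  weak_laplacian Omega (fun x => c * f x) (fun x => c * g x).
Proof.
move=> [Lf Lg w]; split; [exact: L2Z|exact: L2Z|move=> psi tpsi].
have Llap : L2 Omega (fun x => \sum_(i < d) partial i (partial i psi) x).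
  apply: L2_sum => // i; apply: test_function_L2 => //.
  by do 2 apply: test_function_partial.
have := innerZl mO c Lf Llap.
have := innerZl mO c Lg (test_function_L2 oO bO tpsi).
by rewrite /inner => -> ->; rewrite w.
Qed.

End scaling.

Section standing_wave.
Context {R : realType} {d : nat}.
Local Notation E := 'rV[R]_d.
Local Notation mu := (@lebesgue_rV R d).
Variables (Omega : set E) (V : E -> R) (lam : R) (phi : E -> R).
Hypotheses (oO : open Omega) (bO : bounded_set Omega).
Hypothesis ephi : eigenfunction Omega V lam phi.

Let mO : measurable Omega. Proof. exact: open_measurable_rV. Qed.

(** The function exp(i lam t) phi. *)
Definition standing_wave (t : R) (x : E) : R[i] :=
  Complex (cos (lam * t) * phi x) (sin (lam * t) * phi x).

Definition standing_wave_dt (t : R) (x : E) : R[i] :=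
  Complex (- (lam * sin (lam * t)) * phi x) (lam * cos (lam * t) * phi x).

Lemma cvg_L2_difference_quotient (k : R -> R) (dk t : R) : L2 Omega phi ->
  is_derive t (1 : R) k dk ->
  cvg_L2 0^' Omega (fun h x => (k (t + h) * phi x - k t * phi x) / h)
    (fun x => dk * phi x).
Proof.
move=> Lphi [dk1 dkE].
rewrite (_ : (fun h => _) = fun h x => ((k (t + h) - k t) / h) * phi x).
  apply: cvg_L2_scale => //.
  have := dk1; rewrite /derivable -dkE => c; apply: cvg_trans c.
  apply: near_eq_cvg; apply: nearW => h /=.
  by rewrite [h *: 1]mulr1 (addrC h) mulrC.
by apply/funext => h; apply/funext => x; rewrite -mulrBl mulrAC.
Qed.

Lemma standing_wave_solution :
  schrodinger_solution Omega V standing_wave standing_wave_dt.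
Proof.
have [[Hphi H2phi [lap lapphi elap]] _] := ephi.
have [Lphi _] := Hphi; split.
- by split; exact: H2Z.
- by move=> t; split; exact: H10Z.
- move=> t p [->|->].
    split; [exact: L2Z|exact: L2Z|].
    apply: (cvg_L2_difference_quotient (k := fun s => cos (lam * s))) => //.
    by apply: is_derive_eq; rewrite /GRing.scale/=; ring.
  split; [exact: L2Z|exact: L2Z|].
  apply: (cvg_L2_difference_quotient (k := fun s => sin (lam * s))) => //.
  by apply: is_derive_eq; rewrite /GRing.scale/=; ring.
- move=> t.
  exists (fun x => Complex (cos (lam * t) * lap x) (sin (lam * t) * lap x)).
  split; [exact: weak_laplacianZ|exact: weak_laplacianZ|].
  apply: filterS elap => x elap Ox; have {}elap := elap Ox.
  have lapE : lap x = V x * phi x - lam * phi x by rewrite elap; ring.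
  rewrite lapE /standing_wave /standing_wave_dt.
  by apply/eqP; rewrite eq_complex /=; apply/andP; split; apply/eqP; ring.
Qed.

(** The modulus of exp(i lam t) is 1, so the time dependence disappears. *)
Lemma integral_sqmod_standing_wave_dt (A : set E) t : measurable A ->
  A `<=` Omega ->
  \int[mu]_(x in A) sqmod (standing_wave_dt t x) =
  lam ^+ 2 * \int[mu]_(x in A) (phi x ^+ 2).
Proof.
move=> mA AO; have [[[Lphi _] _ _] _] := ephi.
rewrite -RintegralZl//; last exact: (L2_subset mO mA AO Lphi).2.
apply: eq_Rintegral => x _; rewrite /sqmod /=.
rewrite -[RHS]mul1r -(cos2Dsin2 (lam * t)); ring.
Qed.

Lemma standing_wave_quotient (omega : set E) : measurable omega ->
  omega `<=` Omega -> lam != 0 -> \int[mu]_(x in Omega) (phi x ^+ 2) = 1 ->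
  obs_quotient Omega omega standing_wave_dt T @[T --> +oo] -->
    \int[mu]_(x in omega) (phi x ^+ 2).
Proof.
move=> mo oOm lam0 phi1; apply: cvg_near_cst; near=> T.
have T0 : 0 < T by near: T; exact: nbhs_pinfty_gt.
rewrite /obs_quotient integral_sqmod_standing_wave_dt// phi1.
under eq_Rintegral do rewrite integral_sqmod_standing_wave_dt//.
rewrite Rintegral_cst_itv ?(ltW T0)//.
by field; rewrite lam0 gt_eqF.
Unshelve. all: end_near. Qed.

End standing_wave.

(** * The observability constant *)

Theorem corollary2p2 (R : realType) (d : nat) (Omega : set 'rV[R]_d)
    (V : 'rV[R]_d -> R) (lambda : nat -> R) (phi : nat -> 'rV[R]_d -> R)
    (hOmega : bounded_domain Omega)
    (hV : Linfty Omega V)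
    (hphi : orthonormal_basis Omega phi)
    (heigen : forall j, eigenfunction Omega V (lambda j) (phi j))
    (hlambda : forall j, lambda j != 0) :
  (forall omega : set 'rV[R]_d, measurable omega -> omega `<=` Omega ->
     C_infty Omega V omega <= J_inf omega phi) /\
  (simple_eigenvalues Omega V ->
   forall omega : set 'rV[R]_d, measurable omega -> omega `<=` Omega ->
     C_infty Omega V omega =
       inf (range (fun j => \int[lebesgue_rV d]_(x in omega) (phi j x ^+ 2))) /\
     inf (range (fun j => \int[lebesgue_rV d]_(x in omega) (phi j x ^+ 2))) =
       J_inf omega phi).
Proof.
have [oO _ _ bO] := hOmega.
have mO : measurable Omega by exact: open_measurable_rV.
have [_ ortho _] := hphi.
have norm1 j : \int[lebesgue_rV d]_(x in Omega) (phi j x ^+ 2) = 1.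
  transitivity ((j == j)%:R : R); last by rewrite eqxx.
  by rewrite -ortho; apply: eq_Rintegral => x _; rewrite expr2.
have wave (omega : set 'rV[R]_d) j : measurable omega -> omega `<=` Omega ->
    exists u dtu : R -> 'rV[R]_d -> R[i],
    [/\ schrodinger_solution Omega V u dtu,
        \int[lebesgue_rV d]_(x in Omega) sqmod (dtu 0 x) != 0 &
        obs_quotient Omega omega dtu T @[T --> +oo] -->
          \int[lebesgue_rV d]_(x in omega) (phi j x ^+ 2)].
  move=> mo oOm; exists (standing_wave (lambda j) (phi j)).
  exists (standing_wave_dt (lambda j) (phi j)); split.
  - exact: standing_wave_solution.
  - by rewrite (integral_sqmod_standing_wave_dt oO (heigen j))// norm1 mulr1
      expf_neq0.
  - exact: (standing_wave_quotient oO (heigen j) mo oOm (hlambda j) (norm1 j)).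
have le (omega : set 'rV[R]_d) : measurable omega -> omega `<=` Omega ->
    C_infty Omega V omega <= J_inf omega phi.
  move=> mo oOm; apply: lb_le_inf => [|_ [j _ <-]]; first by eexists; exists 0%N.
  apply: ge_inf; last exact: wave.
  exists 0 => l [u [dtu [_ _ cl]]].
  apply: (ler_cvg_to (cvg_cst 0) cl); near=> T.
  have T0 : 0 < T by near: T; exact: nbhs_pinfty_gt.
  have sq0 (A : set 'rV[R]_d) t :
      0 <= \int[lebesgue_rV d]_(x in A) sqmod (dtu t x).
    by apply: Rintegral_ge0 => x _; rewrite addr_ge0// sqr_ge0.
  rewrite mulr_ge0 ?invr_ge0 ?(ltW T0)// divr_ge0//.
  by apply: Rintegral_ge0 => t _.
split=> // simp omega mo oOm; split=> //.
apply/le_anti/andP; split; first exact: le.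
apply: lb_le_inf => [|l [u [dtu [hu en0 cl]]]].
  by eexists; exact: (wave omega 0%N).
have linj := simple_eigenvalues_inj oO hphi heigen simp.
exact: (observation_lower_bound oO bO hphi heigen hu mo oOm linj en0 cl).
Unshelve. all: end_near.
Qed.
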